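(* Let $G$ be a group and let $A$ and $B$ be two finite sets. Let $X \subset A^G$ and $Y \subset B^G$ be two conjugate subshifts. Then $X$ is strongly irreducible if and only if $Y$ is strongly irreducible.
   Context: $A^G$ is the set of all maps $x \colon G \to A$ with the product of the discrete topologies; $G$ acts by $(gx)(h) = x(g^{-1}h)$; similarly for $B^G$. A subshift is a closed $G$-invariant subset. Two subshifts $X \subset A^G$ and $Y \subset B^G$ are conjugate if there exists a $G$-equivariant homeomorphism from $X$ onto $Y$. For $\Omega,\Delta \subset G$ put $\Omega^{+\Delta} = \{g \in G : g\Delta \cap \Omega \neq \varnothing\} = \Omega\Delta^{-1}$. A subshift $X$ is strongly irreducible if there is a finite $\Delta \subset G$ such that for all finite $\Omega_1,\Omega_2 \subset G$ with $\Omega_1^{+\Delta} \cap \Omega_2 = \varnothing$ and all $x_1,x_2 \in X$ there is $x \in X$ coinciding with $x_1$ on $\Omega_1$ and with $x_2$ on $\Omega_2$. *)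

(* Defs.v *)
From mathcomp Require Import all_boot.
From mathcomp Require Import all_classical.
From mathcomp Require Import topology.

Set Implicit Arguments.
Unset Strict Implicit.
Unset Printing Implicit Defensive.

Local Open Scope classical_set_scope.
Local Open Scope group_scope.

(* A^G with the prodiscrete topology. *)
Definition config (G : groupType) (A : finType) : topologicalType :=
  {ptws G -> discrete_topology A}.

Definition shift (G : groupType) (A : finType) (g : G) (x : config G A) :
    config G A :=
  fun h => x (g^-1 * h).

Record subshift (G : groupType) (A : finType) := Subshift {
  subshift_set :> set (config G A);
  subshift_closed : closed subshift_set;
  subshift_invariant :
    forall (g : G) x, subshift_set x -> subshift_set (shift g x)
}.

(* The action of G on a subshift X, as an action on the type of points of X;
   this type carries the topology induced by A^G. *)
Definition subshift_act (G : groupType) (A : finType) (X : subshift G A)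
    (g : G) (x : X) : X :=
  SigSub (mem_set (subshift_invariant g (set_valP x))).

Definition homeomorphism (S T : topologicalType) (f : S -> T) : Prop :=
  continuous f /\
  exists f' : T -> S, [/\ continuous f', cancel f f' & cancel f' f].

(* The homeomorphism is between the point types of X and Y, not between the full
   shifts, so that empty alphabets cause no degeneracy. *)
Definition conjugate (G : groupType) (A B : finType)
    (X : subshift G A) (Y : subshift G B) : Prop :=
  exists f : X -> Y,
    homeomorphism f /\
    forall (g : G) (x : X), f (subshift_act g x) = subshift_act g (f x).

(* The Delta-neighbourhood of Omega: all g such that g Delta meets Omega. *)
Definition neighborhood (G : groupType) (Omega Delta : set G) : set G :=
  [set g : G | [set g * d | d in Delta] `&` Omega !=set0].

Definition strongly_irreducible (G : groupType) (A : finType)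
    (X : set (config G A)) : Prop :=
  exists Delta : set G, finite_set Delta /\
    forall Omega1 Omega2 : set G, finite_set Omega1 -> finite_set Omega2 ->
      neighborhood Omega1 Delta `&` Omega2 = set0 ->
      forall x1 x2 : config G A, X x1 -> X x2 ->
        exists x : config G A,
          [/\ X x, forall h, Omega1 h -> x h = x1 h
               & forall h, Omega2 h -> x h = x2 h].

(* Main.v *)
Require Import Defs.
From mathcomp Require Import all_boot.
From mathcomp Require Import finmap.
From mathcomp Require Import all_classical.
From mathcomp Require Import topology.

Set Implicit Arguments.
Unset Strict Implicit.
Unset Printing Implicit Defensive.

Local Open Scope classical_set_scope.
Local Open Scope group_scope.

(** By compactness, the coordinate at 1 of the image under a continuous
equivariant map depends on finitely many coordinates only, say those in [M];
by equivariance the coordinate at [g] then depends on those in [g M].  Hence if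
[Delta] witnesses strong irreducibility of the source, [M Delta M^-1]
witnesses that of the image. *)

Definition agree {G : groupType} {A : finType} (M : set G) (x y : config G A) :=
  forall h, M h -> x h = y h.

Lemma nbhs_agree {G : groupType} {A : finType} (x : config G A) (M : set G) :
  finite_set M -> nbhs x (agree M x).
Proof.
case/finite_fsetP => D ->.
suff -> : agree [set` D] x = \bigcap_(h in [set` D]) [set y | x h = y h].
  apply: filter_bigI => h _.
  apply: (@proj_continuous G (fun=> discrete_topology A) h x [set a | x h = a]).
  by apply: open_nbhs_nbhs; split => //; exact: discrete_open.
by apply/seteqP; split => y xy h Dh; exact: xy.
Qed.

(** The sets containing some [agree M x] with [M] finite form a filter, and the claim is that this
    filter converges to [x]. *)
Lemma agree_sub_nbhs {G : groupType} {A : finType} (x : config G A)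
    (U : set (config G A)) :
  nbhs x U -> exists2 M : set G, finite_set M & agree M x `<=` U.
Proof.
pose F : set_system (config G A) := filter_from finite_set (agree ^~ x).
have FF : Filter F.
  apply: filter_from_filter; first by exists set0.
  move=> M N fM fN; exists (M `|` N); first by rewrite finite_setU.
  by move=> y xy; split => h Mh; apply: xy; [left|right].
suff Fx : F --> x by move=> /Fx.
(* The product topology is the supremum of those induced by the projections, so convergence is
   tested one coordinate at a time. *)
apply/cvg_sup => h V [_ [[B _ <-] Bxh BV]].
exists [set h]; first exact: finite_set1.
by move=> y xy; apply: BV; rewrite /= -(xy h).
Qed.

Lemma compact_config {G : groupType} {A : finType} :
  compact [set: config G A].
Proof.
have := @tychonoff G (fun=> discrete_topology A) (fun=> setT)
  (fun=> @finite_compact (discrete_topology A) setT (@finite_finset A setT)).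
by congr compact; apply/seteqP; split.
Qed.

(** Around each point of [X] the map [f] is constant on a set cut out by finitely many coordinates;
    compactness, in its near-covering form, merges these local windows into one. *)
Lemma continuous_discrete_finite_memory {G : groupType} {A : finType}
    (X : set (config G A)) (T : discreteTopologicalType) (f : X -> T) :
  closed X -> continuous f ->
  exists2 M : set G, finite_set M &
    forall z z' : X, agree M (val z) (val z') -> f z = f z'.
Proof.
move=> clX cf.
have /compact_near_coveringP ncX : compact X.
  exact: subclosed_compact clX compact_config _.
(* Eventually along [F] means for all windows containing some fixed finite set. *)
pose F : set_system (set G) :=
  filter_from finite_set (fun M => [set N | M `<=` N]).
have FF : Filter F.
  apply: filter_from_filter; first by exists set0.
  move=> M N fM fN; exists (M `|` N); first by rewrite finite_setU.
  by move=> P; rewrite /= subUset.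
(* The covering ranges over points of [config G A] while [f] lives on [X], hence the equation
   [val z = x]. *)
pose P (M : set G) (x : config G A) := forall z z' : X,
  val z = x -> agree M (val z) (val z') -> f z = f z'.
have [x Xx|M fM /(_ M (@subset_refl _ M)) XP] := ncX _ F P FF; last first.
  by exists M => // z z' zz'; apply: (XP (val z)) => //; exact: set_valP.
pose z0 : X := SigSub (mem_set Xx).
have : nbhs z0 (f @^-1` [set f z0]).
  by apply: cf; exact: discrete_set1.
case=> _ [[B oB <-] Bx Bf].
have [M fM MB] : exists2 M, finite_set M & agree M x `<=` B.
  by apply: agree_sub_nbhs; exact: open_nbhs_nbhs.
exists (agree M x, [set N | M `<=` N]).
  by split; [exact: nbhs_agree|exists M].
(* Both [z] and [z'] agree with [x] on [M], hence lie in [B], where [f] takes the value [f z0]. *)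
move=> [y N] [/= xy MN] z z' zy zz'.
have -> : f z = f z0 by apply: Bf; apply: MB; rewrite /= set_valE zy.
suff -> : f z' = f z0 by [].
apply: Bf; apply: MB => h Mh; rewrite /= set_valE.
by rewrite (xy h Mh) -zy; apply: zz'; exact: MN.
Qed.

(** Stated for equivariant surjections, so that it applies to a conjugacy and to its inverse
    alike. *)
Lemma strongly_irreducible_factor {G : groupType} {A B : finType}
    (X : subshift G A) (Y : subshift G B) (f : X -> Y) :
  continuous f ->
  (forall g x, f (subshift_act g x) = subshift_act g (f x)) ->
  (forall y, exists x, f x = y) ->
  strongly_irreducible X -> strongly_irreducible Y.
Proof.
move=> cf ef sf [D [fD siX]].
pose ev1 (y : Y) : discrete_topology B := val y 1.
have cev1 : continuous ev1.
  move=> y; apply: (@continuous_comp Y (config G B) _ set_val (@proj G _ 1)).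
    exact: initial_continuous.
  exact: (@proj_continuous G (fun=> discrete_topology B)).
have cf1 : continuous (ev1 \o f).
  by move=> x; apply: continuous_comp; [exact: cf|exact: cev1].
have [M fM Mf] := continuous_discrete_finite_memory (@subshift_closed _ _ X) cf1.
have val_f (x : X) g : val (f x) g = val (f (subshift_act g^-1 x)) 1.
  by rewrite ef /= /shift invgK mulg1.
have fM_agree (Omega : set G) (x x' : X) :
    agree [set g * m | g in Omega & m in M] (val x) (val x') ->
    agree Omega (val (f x)) (val (f x')).
  move=> xx' g Og; rewrite (val_f x g) (val_f x' g); apply: Mf => m Mm /=.
  by rewrite /shift invgK; apply: xx'; exists g => //; exists m.
exists [set md * m^-1 | md in [set m * d | m in M & d in D] & m in M].
split; first by do 2?apply: finite_image2.
move=> O1 O2 fO1 fO2 O12 y1 y2 Yy1 Yy2.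
have [x1 fx1] := sf (SigSub (mem_set Yy1)).
have [x2 fx2] := sf (SigSub (mem_set Yy2)).
have [|||||x [Xx xx1 xx2]] := siX [set g * m | g in O1 & m in M]
    [set g * m | g in O2 & m in M] _ _ _ (val x1) (val x2).
- exact: finite_image2.
- exact: finite_image2.
(* From [h = g' m'] and [h d = g m] follows [g' (m' d m^-1) = g], which puts [g'] in the forbidden
   intersection. *)
- rewrite -subset0 => h [[_ [[d Dd <-] [g O1g [m Mm gm]]]] [g' O2g' [m' Mm' g'm']]].
  suff : (set0 : set G) g' by [].
  rewrite -O12; split => //; exists g; split => //.
  exists (m' * d * m^-1).
    by exists (m' * d); [exists m' => //; exists d|exists m].
  by rewrite !mulgA g'm' -gm mulgK.
- exact: set_valP.
- exact: set_valP.
pose z : X := SigSub (mem_set Xx).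
exists (val (f z)); split; first exact: set_valP.
- by have := @fM_agree O1 z x1 xx1; rewrite fx1.
- by have := @fM_agree O2 z x2 xx2; rewrite fx2.
Qed.

Theorem corollary3p6 (G : groupType) (A B : finType)
    (X : subshift G A) (Y : subshift G B) :
  conjugate X Y -> strongly_irreducible X <-> strongly_irreducible Y.
Proof.
move=> [f [[cf [f' [cf' fK f'K]]] ef]]; split.
  by apply: (strongly_irreducible_factor cf ef) => y; exists (f' y).
apply: (strongly_irreducible_factor cf') => [g y|x]; last by exists (f x).
(* Equivariance of [f'] is checked after applying the injective map [f]. *)
by apply: (can_inj fK); rewrite ef !f'K.
Qed.
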